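(* Let $A_0A_1A_2$ be a translation triangle in $\mathbf{Sol}$ with translation triangular surface $\mathcal{S}=\mathcal{S}^{\mathbf{Sol},t}_{A_0A_1A_2}$, and let $T\in\mathcal{S}$ be a point not on any side of the triangle. Let $A_0T,A_1T,A_2T\subset\mathcal{S}$ be the connecting curves in $\mathcal{S}$, and suppose that $A_0T$ and $g^{\mathbf{Sol}}_{A_1A_2}$ meet in $Q$, that $A_1T$ and $g^{\mathbf{Sol}}_{A_0A_2}$ meet in $R$, and that $A_2T$ and $g^{\mathbf{Sol}}_{A_0A_1}$ meet in $P$. Then $$s_g^{\mathbf{Sol}}(A_0,P,A_1)\,s_g^{\mathbf{Sol}}(A_1,Q,A_2)\,s_g^{\mathbf{Sol}}(A_2,R,A_0)=1.$$
   Context: Model. $\mathbf{Sol}$ is $\mathbb{R}^3$ with points $(x,y,z)$, also written $(1,x,y,z)$. The translation by $(x,y,z)$ maps $(a,b,c)\mapsto(x+ae^{-z},\,y+be^{z},\,z+c)$ and carries the origin to $(x,y,z)$. The isometries fixing the origin form a group of order 8 generated by $(x,y,z)\mapsto(x,-y,z)$ and $(x,y,z)\mapsto(y,x,-z)$. Translation curves. The unit-velocity translation curve starting at the origin with direction parameters $\phi\in(-\pi,\pi]$, $\theta\in[-\frac\pi2,\frac\pi2]$, i.e. with initial tangent $(\cos\theta\cos\phi,\cos\theta\sin\phi,\sin\theta)$, is $x(t)=-\cot\theta\cos\phi\,(e^{-t\sin\theta}-1)$, $y(t)=\cot\theta\sin\phi\,(e^{t\sin\theta}-1)$, $z(t)=t\sin\theta$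 if $\theta\neq0$, and $x(t)=t\cos\phi$, $y(t)=t\sin\phi$, $z(t)=0$ if $\theta=0$. Translation curves starting at another point are the images of these under the translation carrying the origin to that point. Two distinct points $A,B$ determine a translation curve $g^{\mathbf{Sol}}_{AB}$ (taken as a full curve); its parameters $\phi,\theta$ are those obtained after translating $A$ to the origin and directing the curve from $A$ to $B$. The translation distance $d^{\mathbf{Sol},t}(A,B)$ is the parameter $t\ge0$ at which the unit-velocity translation curve starting at $A$ reaches $B$. Simple ratio. Let $A,P,B$ be distinct points on a translation curve, where $A$ may be assumed, after a translation, to be the origin, and let $\theta$ be the parameter of the curve. (1) If the curve does not lie in the $[x,y]$ coordinate plane (and is not in one of the cases (2), (3)), then $s_g^{\mathbf{Sol}}(A,P,B)=\dfrac{1-e^{-d^{\mathbf{Sol},t}(A,P)\sin\theta}}{e^{-d^{\mathbf{Sol},t}(A,P)\sin\theta}-e^{-d^{\mathbf{Sol},t}(A,B)\sin\theta}}$ if $P$ is between $A$ and $B$, and $s_g^{\mathbf{Sol}}(A,P,B)$ is minus this expression otherwise. (2) If the curve lies in the $[x,y]$ plane or in the $z$-axis, then $s_g^{\mathbf{Sol}}(A,P,B)=d^{\mathbf{Sol},t}(A,P)/d^{\mathbf{Sol},t}(P,B)$ if $P$ is between $A$ and $B$, and minus this otherwise. (3) If the curve lies in the $[y,z]$ plane, one applies an isometry of $\mathbf{Sol}$ fixing the origin and mapping the $[y,z]$ plane to the $[x,z]$ plane, and the simple ratio is that of the image points computed by (1). Triangle and surface. A translation triangle $A_0A_1A_2$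 is given by three points not on one translation curve; its sides are the translation segments joining the vertices. The surface $\mathcal{S}^{\mathbf{Sol},t}_{A_0A_1A_2}$ is the set of all points $P$ such that the tangent vectors at $P$ of the translation curves from $P$ to $A_0,A_1,A_2$ are coplanar (vertices included). Connecting curves. After a translation one may assume $A_0$ is the origin. Let $m$ be the map $(x,z)\mapsto(x,e^{-z})$ from the $[x,z]$ plane to the upper half-plane, and let $P^p$ denote the Euclidean orthogonal projection of a point $P$ onto the $[x,z]$ plane and $P^m=m(P^p)$. For $P_1,P_2\in\mathcal{S}^{\mathbf{Sol},t}_{A_0A_1A_2}$ the connecting curve $P_1P_2$ is defined as follows. (i) If $A_1,A_2$ both lie in the $[y,z]$ plane or both lie in the $[x,z]$ plane, it is the translation curve through $P_1,P_2$, lying in that plane. (ii) Otherwise, if $P_1^p\ne P_2^p$, let $g^{m}$ be the Euclidean line through $P_1^m,P_2^m$, let $g^{p}=m^{-1}(g^{m})$, and let $\mathcal{CS}_{P_1,P_2}$ be the cylindrical surface consisting of all lines parallel to the $y$-axis through points of $g^p$; the connecting curve is $\mathcal{S}^{\mathbf{Sol},t}_{A_0A_1A_2}\cap\mathcal{CS}_{P_1,P_2}$. (iii) Otherwise, if $P_1^p=P_2^p$, let $\mathcal{CS}_{P_1,P_2}$ be the Euclidean plane parallel to the $[y,z]$ plane containing $P_1^p$; the connecting curve is $\mathcal{S}^{\mathbf{Sol},t}_{A_0A_1A_2}\cap\mathcal{CS}_{P_1,P_2}$.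
   Formalization: Adds: no side parallel to the z-axis; if one side lies in a (translated) [y,z] plane, the whole triangle does. ''Meet in'' means a unique point. If P is not between A and B, the ratio in (1) uses the signed distance of P and is minus the absolute value. Otherwise the claim fails. *)

(* Defs.v *)
From Stdlib Require Import Reals ClassicalEpsilon.
Open Scope R_scope.

(** Sol as R^3, with its translations acting on the left. *)

Record point := Pt { px : R; py : R; pz : R }.

Definition origin : point := Pt 0 0 0.

Definition translate (A X : point) : point :=
  Pt (px A + px X * exp (- pz A)) (py A + py X * exp (pz A)) (pz A + pz X).

(* Inverse of [translate A]: the translation carrying [A] to the origin. *)
Definition to_origin (A X : point) : point :=
  Pt ((px X - px A) * exp (pz A)) ((py X - py A) * exp (- pz A)) (pz X - pz A).

Lemma translate_to_origin (A X : point) : translate A (to_origin A X) = X.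
Proof.
destruct A as [a b c], X as [x y z]; unfold translate, to_origin; simpl.
rewrite !Rmult_assoc, <- !exp_plus, Rplus_opp_r, Rplus_opp_l, exp_0.
f_equal; ring.
Qed.

Lemma to_origin_translate (A X : point) : to_origin A (translate A X) = X.
Proof.
destruct A as [a b c], X as [x y z]; unfold translate, to_origin; simpl.
replace (a + x * exp (- c) - a) with (x * exp (- c)) by ring.
replace (b + y * exp c - b) with (y * exp c) by ring.
rewrite !Rmult_assoc, <- !exp_plus, Rplus_opp_r, Rplus_opp_l, exp_0.
f_equal; ring.
Qed.

(* One of the isometries fixing the origin; it exchanges the [y,z] and [x,z]
   planes. *)
Definition swap (X : point) : point := Pt (py X) (px X) (- pz X).

Definition plane_xy (X : point) : Prop := pz X = 0.
Definition plane_xz (X : point) : Prop := py X = 0.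
Definition plane_yz (X : point) : Prop := px X = 0.
Definition axis_z (X : point) : Prop := px X = 0 /\ py X = 0.

(** Translation curves. *)

Definition dir_range (phi theta : R) : Prop :=
  - PI < phi <= PI /\ - (PI / 2) <= theta <= PI / 2.

Definition cot (theta : R) : R := cos theta / sin theta.

Definition tcurve0 (phi theta t : R) : point :=
  if Req_EM_T theta 0 then Pt (t * cos phi) (t * sin phi) 0
  else Pt (- cot theta * cos phi * (exp (- (t * sin theta)) - 1))
          (cot theta * sin phi * (exp (t * sin theta) - 1))
          (t * sin theta).

Definition tcurve (A : point) (phi theta t : R) : point :=
  translate A (tcurve0 phi theta t).

(* The parameters of the curve from [A] to [B].  They are unique, except that
   [phi] is arbitrary when [theta] is PI/2 or -PI/2, where [tcurve] does not
   depend on it; there are none when [A = B]. *)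
Definition tdir (A B : point) (phi theta : R) : Prop :=
  dir_range phi theta /\ exists t, 0 < t /\ B = tcurve A phi theta t.

Definition tdist (A B : point) : R :=
  epsilon (inhabits 0) (fun t =>
    0 <= t /\ exists phi theta, dir_range phi theta /\ B = tcurve A phi theta t).

Definition ttheta (A B : point) : R :=
  epsilon (inhabits 0) (fun theta => exists phi, tdir A B phi theta).

(* The full curve, the ray from [A], the segment, and the open segment. *)
Definition on_tcurve (A B X : point) : Prop :=
  exists phi theta t, tdir A B phi theta /\ X = tcurve A phi theta t.

Definition on_tray (A B X : point) : Prop :=
  exists phi theta t, tdir A B phi theta /\ 0 <= t /\ X = tcurve A phi theta t.

Definition on_tsegment (A B X : point) : Prop :=
  exists phi theta t,
    tdir A B phi theta /\ 0 <= t <= tdist A B /\ X = tcurve A phi theta t.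

Definition between (A X B : point) : Prop :=
  exists phi theta t,
    tdir A B phi theta /\ 0 < t < tdist A B /\ X = tcurve A phi theta t.

(* The curve [AB], with [A] translated to the origin, lies in [F]. *)
Definition tcurve_in (A B : point) (F : point -> Prop) : Prop :=
  forall X, on_tcurve A B X -> F (to_origin A X).

(** Simple ratio. *)

(* The distance from [A] to [X], counted negatively when [A] separates [X] from
   [B]: the parameter of [X] on the curve directed from [A] to [B]. *)
Definition sdist (A B X : point) : R :=
  if excluded_middle_informative (on_tray A B X) then tdist A X else - tdist A X.

(* When [P] is between [A] and [B], [sdist A B P = tdist A P] and the quotient
   is positive.  Otherwise the quotient of the signed differences may already be
   negative, hence the absolute value before the sign is put in front. *)
Definition sratio_gen (A P B : point) : R :=
  let s := sin (ttheta A B) in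
  let q := (1 - exp (- (sdist A B P * s)))
           / (exp (- (sdist A B P * s)) - exp (- (tdist A B * s))) in
  if excluded_middle_informative (between A P B) then q else - Rabs q.

Definition sratio_dist (A P B : point) : R :=
  if excluded_middle_informative (between A P B)
  then tdist A P / tdist P B else - (tdist A P / tdist P B).

Definition sratio (A P B : point) : R :=
  if excluded_middle_informative (tcurve_in A B plane_xy \/ tcurve_in A B axis_z)
  then sratio_dist A P B
  else if excluded_middle_informative (tcurve_in A B plane_yz)
  then sratio_gen origin (swap (to_origin A P)) (swap (to_origin A B))
  else sratio_gen A P B.

(** Triangles and their surfaces. *)

Definition ttriangle (A0 A1 A2 : point) : Prop :=
  ~ exists S phi theta t0 t1 t2, dir_range phi theta /\
      A0 = tcurve S phi theta t0 /\ A1 = tcurve S phi theta t1 /\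
      A2 = tcurve S phi theta t2.

(* [v] is the velocity at [P] of the translation curve from [P] to [A]. *)
Definition ttangent (P A v : point) : Prop :=
  exists phi theta, tdir P A phi theta /\
    derivable_pt_lim (fun t => px (tcurve P phi theta t)) 0 (px v) /\
    derivable_pt_lim (fun t => py (tcurve P phi theta t)) 0 (py v) /\
    derivable_pt_lim (fun t => pz (tcurve P phi theta t)) 0 (pz v).

Definition dot (u v : point) : R := px u * px v + py u * py v + pz u * pz v.

Definition coplanar (v0 v1 v2 : point) : Prop :=
  exists n, n <> origin /\ dot n v0 = 0 /\ dot n v1 = 0 /\ dot n v2 = 0.

Definition surface (A0 A1 A2 P : point) : Prop :=
  P = A0 \/ P = A1 \/ P = A2 \/
  exists v0 v1 v2, ttangent P A0 v0 /\ ttangent P A1 v1 /\ ttangent P A2 v2 /\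
    coplanar v0 v1 v2.

(** Connecting curves.  Points of the [x,z] plane and of the upper half-plane
    are pairs. *)

Definition proj (P : point) : R * R := (px P, pz P).

Definition mmap (p : R * R) : R * R := (fst p, exp (- snd p)).

Definition on_line (a b c : R * R) : Prop :=
  exists l, c = (fst a + l * (fst b - fst a), snd a + l * (snd b - snd a)).

(* The inverse image under [mmap] of the line through the images of
   [proj P1] and [proj P2]. *)
Definition on_gp (P1 P2 : point) (c : R * R) : Prop :=
  on_line (mmap (proj P1)) (mmap (proj P2)) (mmap c).

Definition cylinder (P1 P2 X : point) : Prop :=
  exists c s, on_gp P1 P2 c /\ X = Pt (fst c) s (snd c).

(* The connecting curve [P1 P2] in the surface of the triangle whose first
   vertex is the origin. *)
Definition connecting0 (A1 A2 P1 P2 X : point) : Prop :=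
  let vertical := (plane_yz A1 /\ plane_yz A2) \/ (plane_xz A1 /\ plane_xz A2) in
  (vertical /\ on_tcurve P1 P2 X) \/
  (~ vertical /\ proj P1 <> proj P2 /\ surface origin A1 A2 X /\ cylinder P1 P2 X) \/
  (~ vertical /\ proj P1 = proj P2 /\ surface origin A1 A2 X /\ px X = px P1).

Definition connecting (A0 A1 A2 P1 P2 X : point) : Prop :=
  connecting0 (to_origin A0 A1) (to_origin A0 A2)
    (to_origin A0 P1) (to_origin A0 P2) (to_origin A0 X).

(* [Q] is the point of intersection of [F] and [G]. *)
Definition meet_in (F G : point -> Prop) (Q : point) : Prop :=
  forall X, F X /\ G X <-> X = Q.

(** Ceva's identity holds for the ratio of [exp (- pz)] along a side.
    [sratio] deviates from it on a side along the z-axis, where it uses distances,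
    and on a side in the [y,z] plane, where it uses [exp (pz)]; the latter is
    harmless only when the whole triangle lies in that plane. *)

Definition no_side_along_axis_z (A0 A1 A2 : point) : Prop :=
  ~ tcurve_in A0 A1 axis_z /\ ~ tcurve_in A1 A2 axis_z /\ ~ tcurve_in A2 A0 axis_z.

Definition sides_yz_consistent (A0 A1 A2 : point) : Prop :=
  tcurve_in A0 A1 plane_yz \/ tcurve_in A1 A2 plane_yz \/ tcurve_in A2 A0 plane_yz ->
  plane_yz (to_origin A0 A1) /\ plane_yz (to_origin A0 A2).

(* Main.v *)
Require Import Defs.
From Stdlib Require Import Reals Lra Psatz Classical ClassicalEpsilon.
From Coquelicot Require Import Coquelicot.
Open Scope R_scope.

(** The theorem is the planar theorem of Ceva, read in a half-plane model.

    Write w = exp (- z).  Along a translation curve x is an affine function of w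
    and y is an affine function of 1 / w, so the projection to the upper
    half-plane with coordinates (x, w) sends translation curves to Euclidean
    lines or points, and so does the projection to the half-plane (y, 1 / w).
    The isometry [swap] exchanges the two projections.  The parameter of the
    image line is computed by [line_pos], and the simple ratio of [A], [P], [B] is
    the affine simple ratio of the images: this is immediate when z varies,
    because the exponentials in its definition are the values of w, and it holds
    on a horizontal curve because there the curve is a Euclidean segment.  So
    [sratio] is a ratio of differences of x-coordinates when x varies along the
    side ([sratio_x]), and of y-coordinates otherwise ([sratio_y]).

    A connecting curve is defined so that its image in the half-plane (x, w) is
    contained in the line through the images of its end points, if these
    differ.  Hence, when the
    images of the vertices are not collinear, the points [P], [Q], [U] are the feet
    of three cevians through the image of [T].  With the areas cut off by [T]
    as barycentric weights, the three ratios are quotients of these weights and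
    their product is 1 ([ceva_weights], [ceva_halfplane]).

    It remains to see when the images of the vertices are collinear.  If some
    side has constant x, then by hypothesis the whole triangle lies in one plane
    of constant x; the connecting curves are translation curves, and the argument
    applies to the other half-plane.  Otherwise the three x-coordinates are
    distinct.  If the images were collinear, the equation of the surface
    ([surface_equation]) would put the image of [T] on the same line, since
    otherwise the vertices would lie on one translation curve.  Then the
    connecting curve through [T] from a vertex with another projection would
    contain both other vertices, and its intersection with the opposite side
    would not be a single point ([xarea_neq0]). *)

(** * The exponential form of translation curves *)

(** The mean of [exp (- u)] for [u] between 0 and [c].  It is positive, so that
    [texp] below is a bijection, and it absorbs the case of a horizontal curve. *)
Definition expmean (c : R) : R :=
  if Req_EM_T c 0 then 1 else (1 - exp (- c)) / c.

Lemma expmean_0 : expmean 0 = 1.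
Proof. unfold expmean; destruct (Req_EM_T 0 0); lra. Qed.

Lemma expmean_mul (c : R) : expmean c * c = 1 - exp (- c).
Proof.
unfold expmean; destruct (Req_EM_T c 0) as [->|hc].
- rewrite Ropp_0, exp_0; ring.
- field; exact hc.
Qed.

Lemma expmean_pos (c : R) : 0 < expmean c.
Proof.
unfold expmean; destruct (Req_EM_T c 0) as [->|hc]; [lra|].
destruct (Rlt_or_le 0 c) as [h|h].
- apply Rdiv_lt_0_compat; [|exact h].
  assert (exp (- c) < exp 0) by (apply exp_increasing; lra).
  rewrite exp_0 in *; lra.
- replace ((1 - exp (- c)) / c) with ((exp (- c) - 1) / (- c)) by (field; lra).
  apply Rdiv_lt_0_compat; [|lra].
  assert (exp 0 < exp (- c)) by (apply exp_increasing; lra).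
  rewrite exp_0 in *; lra.
Qed.

Lemma expmean_opp (c : R) : expmean (- c) = expmean c * exp c.
Proof.
destruct (Req_EM_T c 0) as [->|hc].
- rewrite Ropp_0, exp_0; ring.
- apply Rmult_eq_reg_r with (- c); [|lra].
  rewrite expmean_mul, Ropp_involutive.
  replace (expmean c * exp c * - c) with (- (expmean c * c) * exp c) by ring.
  rewrite expmean_mul, exp_Ropp; field; apply Rgt_not_eq, exp_pos.
Qed.

Definition vscale (l : R) (v : point) : point := Pt (l * px v) (l * py v) (l * pz v).

Definition vnorm (v : point) : R := sqrt (dot v v).

Definition direction (phi theta : R) : point :=
  Pt (cos theta * cos phi) (cos theta * sin phi) (sin theta).

(** [expmean] at [c] and at [- c] are the mean scale factors in the directions x
    and y on the way from z = 0 to z = [c].  The translation curves from the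
    origin are the images of the rays under [texp], which removes the
    trigonometric parameters and the case distinction on [theta]. *)
Definition texp (v : point) : point :=
  Pt (px v * expmean (pz v)) (py v * expmean (- pz v)) (pz v).

Definition tlog (X : point) : point :=
  Pt (px X / expmean (pz X)) (py X / expmean (- pz X)) (pz X).

Lemma expmean_neq0 (c : R) : expmean c <> 0.
Proof. apply Rgt_not_eq, expmean_pos. Qed.

Lemma texp_tlog (X : point) : texp (tlog X) = X.
Proof.
destruct X as [x y z]; unfold texp, tlog; simpl.
f_equal; field; apply expmean_neq0.
Qed.

Lemma tlog_texp (v : point) : tlog (texp v) = v.
Proof.
destruct v as [x y z]; unfold texp, tlog; simpl.
f_equal; field; apply expmean_neq0.
Qed.

Lemma tlog_origin : tlog origin = origin.
Proof. unfold tlog, origin; simpl; f_equal; unfold Rdiv; ring. Qed.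

Lemma sin_theta_neq0 (theta : R) :
  - (PI / 2) <= theta <= PI / 2 -> theta <> 0 -> sin theta <> 0.
Proof.
intros [h1 h2] h0; pose proof PI_RGT_0.
destruct (Rlt_or_le 0 theta).
- apply Rgt_not_eq, sin_gt_0; lra.
- apply Rlt_not_eq, sin_lt_0_var; lra.
Qed.

Lemma tcurve0_texp (phi theta t : R) : dir_range phi theta ->
  tcurve0 phi theta t = texp (vscale t (direction phi theta)).
Proof.
intros [_ hth]; unfold tcurve0, texp, vscale, direction; simpl.
destruct (Req_EM_T theta 0) as [->|h0].
- rewrite sin_0, cos_0, Rmult_0_r, Ropp_0, expmean_0; f_equal; ring.
- pose proof (sin_theta_neq0 theta hth h0) as hs.
  unfold cot; f_equal.
  + pose proof (expmean_mul (t * sin theta)) as e.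
    apply Rmult_eq_reg_r with (sin theta); [|exact hs].
    transitivity (cos theta * cos phi * (1 - exp (- (t * sin theta)))).
    * field; exact hs.
    * rewrite <- e; ring.
  + pose proof (expmean_mul (- (t * sin theta))) as e.
    rewrite Ropp_involutive in e.
    apply Rmult_eq_reg_r with (sin theta); [|exact hs].
    transitivity (- (cos theta * sin phi * (1 - exp (t * sin theta)))).
    * field; exact hs.
    * rewrite <- e; ring.
Qed.

Lemma vnorm_vscale_direction (t phi theta : R) :
  vnorm (vscale t (direction phi theta)) = Rabs t.
Proof.
unfold vnorm; rewrite <- sqrt_Rsqr_abs; f_equal.
unfold dot, vscale, direction, Rsqr; simpl.
pose proof (sin2_cos2 phi) as e1; pose proof (sin2_cos2 theta) as e2.
unfold Rsqr in *.
transitivity (t * t * (cos theta * cos theta * (sin phi * sin phi + cos phi * cos phi)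
   + sin theta * sin theta)); [ring|].
rewrite e1.
transitivity (t * t * (sin theta * sin theta + cos theta * cos theta)); [ring|].
rewrite e2; ring.
Qed.

Lemma vnorm_vscale (l : R) (v : point) : vnorm (vscale l v) = Rabs l * vnorm v.
Proof.
unfold vnorm; rewrite <- sqrt_Rsqr_abs, <- sqrt_mult.
- f_equal; unfold dot, vscale, Rsqr; simpl; ring.
- apply Rle_0_sqr.
- unfold dot; nra.
Qed.

Lemma vnorm_sqr (v : point) : vnorm v * vnorm v = dot v v.
Proof. unfold vnorm; apply sqrt_sqrt; unfold dot; nra. Qed.

Lemma vnorm_pos (v : point) : v <> origin -> 0 < vnorm v.
Proof.
intros hv; unfold vnorm; apply sqrt_lt_R0.
destruct v as [a b c]; unfold dot; simpl.
destruct (Req_EM_T a 0), (Req_EM_T b 0), (Req_EM_T c 0); subst; try nra.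
exfalso; apply hv; reflexivity.
Qed.

(** The angle is [acos a] or [- acos a] according to the sign of [b]; the value
    [- PI] does not occur because [b] is then strictly negative. *)
Lemma circle_angle (a b : R) : a * a + b * b = 1 ->
  exists phi, - PI < phi <= PI /\ a = cos phi /\ b = sin phi.
Proof.
intros h.
assert (ha : -1 <= a <= 1) by nra.
pose proof (acos_bound a) as hb.
assert (hs : sin (acos a) = Rabs b).
{ rewrite sin_acos by exact ha; rewrite <- sqrt_Rsqr_abs; f_equal; unfold Rsqr; lra. }
pose proof PI_RGT_0.
destruct (Rle_or_lt 0 b) as [h0|h0].
- exists (acos a); rewrite cos_acos by exact ha; rewrite hs, Rabs_right by lra.
  repeat split; lra.
- exists (- acos a); rewrite cos_neg, sin_neg, cos_acos by exact ha.
  rewrite hs, Rabs_left by lra.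
  repeat split; try lra.
  destruct (Req_EM_T (acos a) PI) as [e|e]; [|lra].
  exfalso; assert (a = -1) by (rewrite <- (cos_acos a ha), e; apply cos_PI).
  subst; nra.
Qed.

Lemma spherical_coordinates (v : point) : v <> origin ->
  exists phi theta, dir_range phi theta /\ v = vscale (vnorm v) (direction phi theta).
Proof.
intros hv; pose proof (vnorm_pos v hv) as hr; pose proof (vnorm_sqr v) as hn.
destruct v as [a b c]; unfold dot in hn; simpl in hn.
set (r := vnorm (Pt a b c)) in *.
set (s := c / r).
assert (ec : c = r * s) by (unfold s; field; lra).
assert (hs : -1 <= s <= 1).
{ assert (s * s <= 1); [|nra].
  apply Rmult_le_reg_r with (r * r); [nra|].
  rewrite ec in hn; nra. }
pose proof (asin_bound s) as hb.
set (k := cos (asin s)).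
assert (hk : k * k = 1 - s * s).
{ unfold k; rewrite cos_asin by exact hs; rewrite sqrt_sqrt; unfold Rsqr; nra. }
destruct (Req_EM_T k 0) as [k0|k0].
(* a vertical vector: every azimuth is admissible *)
- exists 0, (asin s); pose proof PI_RGT_0.
  split; [split; lra|].
  rewrite k0 in hk.
  assert (hab : a * a + b * b = 0).
  { rewrite ec in hn; assert (s * s = 1) by lra. nra. }
  assert (a = 0) by nra; assert (b = 0) by nra.
  unfold vscale, direction; simpl; fold k; rewrite k0, sin_asin by exact hs.
  f_equal; [lra|lra|exact ec].
- destruct (circle_angle (a / (r * k)) (b / (r * k))) as (phi & hphi & ea & eb).
  { replace (a / (r * k) * (a / (r * k)) + b / (r * k) * (b / (r * k)))
      with ((a * a + b * b) / (r * r * (k * k))) by (field; split; lra).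
    replace (a * a + b * b) with (r * r * (k * k)).
    - field; split; lra.
    - rewrite hk, ec in *; lra. }
  exists phi, (asin s); split; [split; lra|].
  unfold vscale, direction; simpl; fold k; rewrite <- ea, <- eb, sin_asin by exact hs.
  f_equal; [field; lra|field; lra|exact ec].
Qed.

Lemma to_origin_eq_origin (A B : point) : to_origin A B = origin -> A = B.
Proof.
intros h; rewrite <- (translate_to_origin A B), h.
destruct A; unfold translate, origin; simpl; f_equal; ring.
Qed.

Lemma to_origin_self (A : point) : to_origin A A = origin.
Proof. unfold to_origin, origin; f_equal; ring. Qed.

Lemma tlog_neq0 (A B : point) : A <> B -> tlog (to_origin A B) <> origin.
Proof.
intros h e; apply h, to_origin_eq_origin.
rewrite <- (texp_tlog (to_origin A B)), e.
unfold texp, origin; simpl; f_equal; ring.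
Qed.

Lemma tcurve_iff (A B : point) (phi theta t : R) : dir_range phi theta ->
  (B = tcurve A phi theta t <->
   tlog (to_origin A B) = vscale t (direction phi theta)).
Proof.
intros h; unfold tcurve; rewrite tcurve0_texp by exact h; split; intros e.
- rewrite e, to_origin_translate; apply tlog_texp.
- rewrite <- e, texp_tlog; symmetry; apply translate_to_origin.
Qed.

(** The spherical coordinates of [tlog] give a parameter, and the norm of [tlog]
    is the only possible one because [direction] has norm 1. *)
Lemma tdist_eq (A B : point) : tdist A B = vnorm (tlog (to_origin A B)).
Proof.
unfold tdist; match goal with |- epsilon ?i ?P = _ =>
  assert (h : P (epsilon i P)); [apply epsilon_spec|] end.
- destruct (excluded_middle_informative (A = B)) as [<-|hne].
  + exists 0; split; [lra|].
    exists 0, 0; pose proof PI_RGT_0.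
    assert (hr : dir_range 0 0) by (split; lra); split; [exact hr|].
    apply tcurve_iff; [exact hr|].
    rewrite to_origin_self, tlog_origin; unfold vscale, origin; simpl; f_equal; ring.
  + pose proof (tlog_neq0 A B hne) as hv.
    destruct (spherical_coordinates _ hv) as (phi & theta & hr & e).
    exists (vnorm (tlog (to_origin A B))); split.
    * apply Rlt_le, vnorm_pos, hv.
    * exists phi, theta; split; [exact hr|]; apply tcurve_iff; assumption.
- destruct h as (ht & phi & theta & hr & e).
  apply tcurve_iff in e; [|exact hr].
rewrite e, vnorm_vscale_direction, Rabs_right; lra.
Qed.

Lemma tdist_pos (A B : point) : A <> B -> 0 < tdist A B.
Proof. intros h; rewrite tdist_eq; apply vnorm_pos, tlog_neq0, h. Qed.

Lemma tdir_iff (A B : point) (phi theta : R) :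
  tdir A B phi theta <-> A <> B /\ dir_range phi theta /\
    tlog (to_origin A B) = vscale (tdist A B) (direction phi theta).
Proof.
split.
- intros (hr & t & ht & e); apply tcurve_iff in e; [|exact hr].
  assert (et : tdist A B = t).
  { rewrite tdist_eq, e, vnorm_vscale_direction, Rabs_right; lra. }
  rewrite et; repeat split; try apply hr; [|exact e].
  intros <-; rewrite tdist_eq, to_origin_self, tlog_origin in et.
  assert (vnorm origin = 0).
  { unfold vnorm, dot, origin; simpl; rewrite !Rmult_0_r, !Rplus_0_r; apply sqrt_0. }
  lra.
- intros (hne & hr & e); split; [exact hr|]; exists (tdist A B); split.
  + apply tdist_pos, hne.
  + apply tcurve_iff; assumption.
Qed.

Lemma tdir_exists (A B : point) : A <> B -> exists phi theta, tdir A B phi theta.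
Proof.
intros h; destruct (spherical_coordinates _ (tlog_neq0 A B h)) as (phi & theta & hr & e).
exists phi, theta; apply tdir_iff; rewrite tdist_eq; auto.
Qed.

(** The simple ratio uses [theta] only through this product, which is the
    difference of the z-coordinates. *)
Lemma sin_ttheta (A B : point) : A <> B ->
  tdist A B * sin (ttheta A B) = pz B - pz A.
Proof.
intros h; unfold ttheta; match goal with |- context [epsilon ?i ?P] =>
  assert (hs : P (epsilon i P)) end.
{ apply epsilon_spec; destruct (tdir_exists A B h) as (phi & theta & hd).
  exists theta, phi; exact hd. }
destruct hs as (phi & hd); apply tdir_iff in hd as (_ & _ & e).
apply (f_equal pz) in e; simpl in e; symmetry; exact e.
Qed.

(** The curve from [A] to [B] with its parameter rescaled to be 0 at [A] and 1
    at [B]. *)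
Definition tpath (A B : point) (l : R) : point :=
  translate A (texp (vscale l (tlog (to_origin A B)))).

Lemma vscale_vscale (k l : R) (v : point) : vscale k (vscale l v) = vscale (k * l) v.
Proof. unfold vscale; simpl; f_equal; ring. Qed.

Lemma tcurve_tpath (A B : point) (phi theta t : R) : tdir A B phi theta ->
  tcurve A phi theta t = tpath A B (t / tdist A B).
Proof.
intros hd; apply tdir_iff in hd as (hne & hr & e).
unfold tcurve, tpath; rewrite tcurve0_texp, e, vscale_vscale by exact hr.
do 3 f_equal; pose proof (tdist_pos A B hne); field; lra.
Qed.

Lemma on_tcurve_iff (A B X : point) :
  on_tcurve A B X <-> A <> B /\ exists l, X = tpath A B l.
Proof.
split.
- intros (phi & theta & t & hd & ->); split; [apply tdir_iff in hd; apply hd|].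
  exists (t / tdist A B); apply tcurve_tpath, hd.
- intros (hne & l & ->); destruct (tdir_exists A B hne) as (phi & theta & hd).
  pose proof (tdist_pos A B hne).
  exists phi, theta, (l * tdist A B); split; [exact hd|].
  rewrite (tcurve_tpath A B) by exact hd; f_equal; field; lra.
Qed.

Lemma on_tray_iff (A B X : point) :
  on_tray A B X <-> A <> B /\ exists l, 0 <= l /\ X = tpath A B l.
Proof.
split.
- intros (phi & theta & t & hd & ht & ->).
  assert (hne : A <> B) by (apply tdir_iff in hd; apply hd).
  split; [exact hne|]; exists (t / tdist A B); split.
  + apply Rle_mult_inv_pos; [exact ht|apply tdist_pos, hne].
  + apply tcurve_tpath, hd.
- intros (hne & l & hl & ->); destruct (tdir_exists A B hne) as (phi & theta & hd).
  pose proof (tdist_pos A B hne).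
  exists phi, theta, (l * tdist A B); split; [exact hd|]; split; [nra|].
  rewrite (tcurve_tpath A B) by exact hd; f_equal; field; lra.
Qed.

Lemma between_iff (A B X : point) :
  between A X B <-> A <> B /\ exists l, 0 < l < 1 /\ X = tpath A B l.
Proof.
split.
- intros (phi & theta & t & hd & ht & ->).
  assert (hne : A <> B) by (apply tdir_iff in hd; apply hd).
  pose proof (tdist_pos A B hne).
  split; [exact hne|]; exists (t / tdist A B); split; [split|].
  + apply Rdiv_lt_0_compat; lra.
  + apply Rmult_lt_reg_r with (tdist A B); [lra|].
    replace (t / tdist A B * tdist A B) with t by (field; lra); lra.
  + apply tcurve_tpath, hd.
- intros (hne & l & hl & ->); destruct (tdir_exists A B hne) as (phi & theta & hd).
  pose proof (tdist_pos A B hne).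
  exists phi, theta, (l * tdist A B); split; [exact hd|]; split; [nra|].
  rewrite (tcurve_tpath A B) by exact hd; f_equal; field; lra.
Qed.

Lemma tdist_tpath (A B : point) (l : R) : tdist A (tpath A B l) = Rabs l * tdist A B.
Proof.
rewrite !tdist_eq; unfold tpath; rewrite to_origin_translate, tlog_texp.
apply vnorm_vscale.
Qed.

Lemma tpath_inj (A B : point) (k l : R) : A <> B -> tpath A B k = tpath A B l -> k = l.
Proof.
intros hne e; apply (f_equal (fun X => tlog (to_origin A X))) in e.
unfold tpath in e; rewrite !to_origin_translate, !tlog_texp in e.
pose proof (tlog_neq0 A B hne) as hv.
destruct (tlog (to_origin A B)) as [a b c]; unfold vscale in e; simpl in e.
injection e as e1 e2 e3.
apply NNPP; intros hkl; apply hv; unfold origin; f_equal;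
  (apply Rmult_eq_reg_l with (k - l); [lra|intros h; apply hkl; lra]).
Qed.

Lemma tpath_0 (A B : point) : tpath A B 0 = A.
Proof.
destruct A as [a b c]; unfold tpath, translate, texp, vscale; simpl; f_equal; ring.
Qed.

Lemma tpath_1 (A B : point) : tpath A B 1 = B.
Proof.
unfold tpath; transitivity (translate A (texp (tlog (to_origin A B)))).
- do 2 f_equal; destruct (tlog (to_origin A B)); unfold vscale; simpl; f_equal; ring.
- rewrite texp_tlog; apply translate_to_origin.
Qed.

Lemma sdist_tpath (A B : point) (l : R) : A <> B ->
  sdist A B (tpath A B l) = l * tdist A B.
Proof.
intros hne; unfold sdist; rewrite tdist_tpath.
destruct (excluded_middle_informative (on_tray A B (tpath A B l))) as [h|h].
- apply on_tray_iff in h as (_ & k & hk & e); apply tpath_inj in e; [|exact hne].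
  rewrite Rabs_right; lra.
- destruct (Rle_or_lt 0 l) as [hl|hl].
  + exfalso; apply h, on_tray_iff; eauto.
  + rewrite Rabs_left by exact hl; ring.
Qed.

(** * Image lines in the half-planes *)

(** The position, on the line carrying the image of [tpath A B] in the half-plane
    (x, exp (- z)), of the point with parameter [l]; here [c] is the difference
    of the z-coordinates of the ends.  For nonzero [c] it equals
    (1 - exp (- l c)) / (1 - exp (- c)). *)
Definition line_pos (c l : R) : R := l * expmean (l * c) / expmean c.

Lemma line_pos_0 (c : R) : line_pos c 0 = 0.
Proof. unfold line_pos, Rdiv; ring. Qed.

Lemma line_pos_1 (c : R) : line_pos c 1 = 1.
Proof. unfold line_pos; rewrite !Rmult_1_l; field; apply expmean_neq0. Qed.

Lemma line_pos_flat (l : R) : line_pos 0 l = l.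
Proof. unfold line_pos; rewrite Rmult_0_r, expmean_0; field. Qed.

Lemma line_pos_exp (c l : R) : exp (- (l * c)) - 1 = line_pos c l * (exp (- c) - 1).
Proof.
pose proof (expmean_mul c) as e1; pose proof (expmean_mul (l * c)) as e2.
replace (exp (- (l * c)) - 1) with (- (expmean (l * c) * (l * c))) by lra.
replace (exp (- c) - 1) with (- (expmean c * c)) by lra.
unfold line_pos; field; apply expmean_neq0.
Qed.

Lemma line_pos_increasing (c k l : R) : k < l -> line_pos c k < line_pos c l.
Proof.
intros h; destruct (Req_EM_T c 0) as [->|hc]; [rewrite !line_pos_flat; exact h|].
pose proof (line_pos_exp c k) as ek; pose proof (line_pos_exp c l) as el.
destruct (Rlt_or_le 0 c) as [h0|h0].
- assert (exp (- c) < exp 0) by (apply exp_increasing; lra).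
  assert (exp (- (l * c)) < exp (- (k * c))) by (apply exp_increasing; nra).
  rewrite exp_0 in *; nra.
- assert (exp 0 < exp (- c)) by (apply exp_increasing; lra).
  assert (exp (- (k * c)) < exp (- (l * c))) by (apply exp_increasing; nra).
  rewrite exp_0 in *; nra.
Qed.

Lemma line_pos_inj (c k l : R) : line_pos c k = line_pos c l -> k = l.
Proof.
intros e; destruct (Rtotal_order k l) as [h|[h|h]]; [|exact h|];
  apply (line_pos_increasing c) in h; lra.
Qed.

Lemma exp_cancel (c : R) : exp c * exp (- c) = 1.
Proof. rewrite <- exp_plus, Rplus_opp_r; apply exp_0. Qed.

Lemma px_tpath (A B : point) (l : R) :
  px (tpath A B l) = px A + line_pos (pz B - pz A) l * (px B - px A).
Proof.
unfold tpath, line_pos, texp, vscale, tlog, translate, to_origin; simpl.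
set (c := pz B - pz A); pose proof (exp_cancel (pz A)) as e.
transitivity (px A + l * expmean (l * c) / expmean c * (px B - px A)
  * (exp (pz A) * exp (- pz A))); [field; apply expmean_neq0|rewrite e; ring].
Qed.

Lemma pz_tpath (A B : point) (l : R) : pz (tpath A B l) = pz A + l * (pz B - pz A).
Proof. reflexivity. Qed.

(** The second coordinate in the half-plane (x, exp (- z)). *)
Definition height (X : point) : R := exp (- pz X).

Lemma height_tpath (A B : point) (l : R) :
  height (tpath A B l) =
  height A + line_pos (pz B - pz A) l * (height B - height A).
Proof.
unfold height; pose proof (line_pos_exp (pz B - pz A) l) as e; rewrite pz_tpath.
replace (- (pz A + l * (pz B - pz A))) with (- pz A + - (l * (pz B - pz A))) by ring.
replace (- pz B) with (- pz A + - (pz B - pz A)) by ring.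
rewrite !exp_plus.
transitivity (exp (- pz A) + exp (- pz A) * (exp (- (l * (pz B - pz A))) - 1)); [ring|].
rewrite e; ring.
Qed.

Lemma swap_swap (X : point) : swap (swap X) = X.
Proof. destruct X; unfold swap; simpl; f_equal; ring. Qed.

Lemma swap_to_origin (A X : point) : swap (to_origin A X) = to_origin (swap A) (swap X).
Proof.
unfold swap, to_origin; simpl; rewrite Ropp_involutive; f_equal; ring.
Qed.

Lemma swap_tpath (A B : point) (l : R) : swap (tpath A B l) = tpath (swap A) (swap B) l.
Proof.
unfold tpath; rewrite <- swap_to_origin.
destruct (to_origin A B) as [x y z]; destruct A as [a b c].
unfold swap, translate, texp, vscale, tlog; simpl.
rewrite !Ropp_involutive; replace (l * - z) with (- (l * z)) by ring.
rewrite Ropp_involutive; f_equal; ring.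
Qed.

Lemma swap_on_tcurve (A B X : point) :
  on_tcurve A B X -> on_tcurve (swap A) (swap B) (swap X).
Proof.
rewrite !on_tcurve_iff; intros (hne & l & ->); split.
- intros e; apply hne; rewrite <- (swap_swap A), e; apply swap_swap.
- exists l; apply swap_tpath.
Qed.

(** The isometry [swap] reduces this to the formula for x; it changes the sign
    of z. *)
Lemma py_tpath (A B : point) (l : R) :
  py (tpath A B l) = py A + line_pos (- (pz B - pz A)) l * (py B - py A).
Proof.
change (py (tpath A B l)) with (px (swap (tpath A B l))).
rewrite swap_tpath, px_tpath; simpl.
replace (- pz B - - pz A) with (- (pz B - pz A)) by ring; reflexivity.
Qed.

Lemma line_pos_reverse (c l : R) : line_pos (- c) (1 - l) = 1 - line_pos c l.
Proof.
destruct (Req_EM_T c 0) as [->|hc]; [rewrite Ropp_0, !line_pos_flat; reflexivity|].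
pose proof (line_pos_exp (- c) (1 - l)) as e1; pose proof (line_pos_exp c l) as e2.
rewrite Ropp_involutive in e1.
replace (- ((1 - l) * - c)) with (c + - (l * c)) in e1 by ring.
rewrite exp_plus in e1; pose proof (exp_cancel c) as e3.
apply Rmult_eq_reg_r with (exp c - 1).
- rewrite <- e1.
  replace (exp (- (l * c))) with (1 + line_pos c l * (exp (- c) - 1)) by lra.
  transitivity (exp c - 1 - line_pos c l * exp c + line_pos c l * (exp c * exp (- c)));
    [ring|rewrite e3; ring].
- intros h; apply hc, exp_inv; rewrite exp_0; lra.
Qed.

Lemma tpath_reverse (A B : point) (l : R) : tpath A B l = tpath B A (1 - l).
Proof.
pose proof (px_tpath A B l) as a1; pose proof (py_tpath A B l) as a2.
pose proof (pz_tpath A B l) as a3.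
pose proof (px_tpath B A (1 - l)) as b1; pose proof (py_tpath B A (1 - l)) as b2.
pose proof (pz_tpath B A (1 - l)) as b3.
replace (pz A - pz B) with (- (pz B - pz A)) in b1, b2 by ring.
rewrite line_pos_reverse in b1, b2.
destruct (tpath A B l) as [x y z], (tpath B A (1 - l)) as [x' y' z'].
cbn [px py pz] in *; f_equal; lra.
Qed.

Lemma on_tcurve_sym (A B X : point) : on_tcurve A B X -> on_tcurve B A X.
Proof.
rewrite !on_tcurve_iff; intros (h & l & ->); split; [auto|].
exists (1 - l); apply tpath_reverse.
Qed.

(** * Simple ratios as affine ratios *)

(** The affine ratio is already nonpositive outside of the segment, so that the
    absolute value and the sign in [sratio_gen] leave it unchanged. *)
Lemma ratio_outside (f : R) : f <= 0 \/ 1 < f -> - Rabs (f / (1 - f)) = f / (1 - f).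
Proof.
intros h; rewrite Rabs_left1; [ring|].
destruct h as [h|h].
- replace (f / (1 - f)) with (- (- f / (1 - f))) by (field; lra).
  assert (0 <= - f / (1 - f)) by (apply Rle_mult_inv_pos; lra); lra.
- replace (f / (1 - f)) with (- (f / (f - 1))) by (field; lra).
  assert (0 < f / (f - 1)) by (apply Rdiv_lt_0_compat; lra); lra.
Qed.

Lemma sratio_gen_tpath (A B : point) (l : R) : pz A <> pz B -> l <> 1 ->
  sratio_gen A (tpath A B l) B =
  line_pos (pz B - pz A) l / (1 - line_pos (pz B - pz A) l).
Proof.
intros hz hl.
assert (hne : A <> B) by (intros e; apply hz; rewrite e; reflexivity).
unfold sratio_gen; rewrite sdist_tpath, Rmult_assoc, !sin_ttheta by exact hne.
set (c := pz B - pz A); assert (hc : c <> 0) by (unfold c; lra).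
pose proof (line_pos_exp c l) as e.
assert (hf : line_pos c l <> 1).
{ rewrite <- (line_pos_1 c); intros h; apply hl, (line_pos_inj c), h. }
assert (hw : exp (- c) - 1 <> 0).
{ intros h; apply hc; assert (h' : exp (- c) = exp 0) by (rewrite exp_0; lra).
  apply exp_inv in h'; lra. }
replace (1 - exp (- (l * c))) with (- line_pos c l * (exp (- c) - 1)) by lra.
replace (exp (- (l * c)) - exp (- c))
  with (- ((1 - line_pos c l) * (exp (- c) - 1))) by lra.
replace (- line_pos c l * (exp (- c) - 1) / - ((1 - line_pos c l) * (exp (- c) - 1)))
  with (line_pos c l / (1 - line_pos c l)) by (field; split; lra).
destruct (excluded_middle_informative (between A (tpath A B l) B)) as [h|h];
  [reflexivity|].
apply ratio_outside.
destruct (Rle_or_lt l 0) as [h0|h0].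
- left; rewrite <- (line_pos_0 c).
  destruct h0 as [h0| ->]; [apply Rlt_le, line_pos_increasing, h0|apply Rle_refl].
- right; rewrite <- (line_pos_1 c); apply line_pos_increasing.
  apply Rnot_le_lt; intros h1; apply h, between_iff; split; [exact hne|].
  exists l; split; [lra|reflexivity].
Qed.

(** A horizontal curve is a Euclidean segment on which [tdist] is proportional to
    the Euclidean distance. *)
Lemma sratio_dist_tpath (A B : point) (l : R) : A <> B -> pz A = pz B -> l <> 1 ->
  sratio_dist A (tpath A B l) B = l / (1 - l).
Proof.
intros hne hz hl; unfold sratio_dist; rewrite tdist_tpath.
assert (hd : tdist (tpath A B l) B = Rabs (1 - l) * tdist A B).
{ rewrite !tdist_eq, <- vnorm_vscale; f_equal.
  unfold tlog, vscale, to_origin; rewrite px_tpath, py_tpath, pz_tpath; simpl.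
  replace (pz B - (pz A + l * (pz B - pz A))) with 0 by (rewrite hz; ring).
  replace (pz B - pz A) with 0 by lra.
  rewrite Ropp_0, expmean_0, !line_pos_flat, Rmult_0_r, Rplus_0_r; f_equal; field. }
rewrite hd; pose proof (tdist_pos A B hne).
assert (hl' : Rabs (1 - l) <> 0) by (apply Rabs_no_R0; lra).
replace (Rabs l * tdist A B / (Rabs (1 - l) * tdist A B)) with (Rabs (l / (1 - l))).
2: { unfold Rdiv; rewrite Rabs_mult, Rabs_inv; field; split; first [exact hl'|lra]. }
destruct (excluded_middle_informative (between A (tpath A B l) B)) as [h|h].
- apply between_iff in h as (_ & k & hk & e); apply tpath_inj in e; [|exact hne].
  subst k; apply Rabs_right, Rle_ge, Rlt_le, Rdiv_lt_0_compat; lra.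
- apply ratio_outside.
  destruct (Rle_or_lt l 0) as [h0|h0]; [left; exact h0|right].
  apply Rnot_le_lt; intros h1; apply h, between_iff; split; [exact hne|].
  exists l; split; [lra|reflexivity].
Qed.

Lemma on_tcurve_left (A B : point) : A <> B -> on_tcurve A B A.
Proof.
intros h; apply on_tcurve_iff; split; [exact h|]; exists 0; symmetry; apply tpath_0.
Qed.

Lemma on_tcurve_right (A B : point) : A <> B -> on_tcurve A B B.
Proof.
intros h; apply on_tcurve_iff; split; [exact h|]; exists 1; symmetry; apply tpath_1.
Qed.

Lemma tcurve_in_plane_xy (A B : point) : A <> B -> tcurve_in A B plane_xy -> pz A = pz B.
Proof.
intros hne h; specialize (h B (on_tcurve_right A B hne)).
unfold plane_xy in h; simpl in h; lra.
Qed.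

Lemma px_to_origin_0 (A X : point) : px (to_origin A X) = 0 <-> px X = px A.
Proof.
simpl; pose proof (exp_pos (pz A)); split; intros h; [|rewrite h; ring].
apply Rmult_integral in h; lra.
Qed.

Lemma py_to_origin_0 (A X : point) : py (to_origin A X) = 0 <-> py X = py A.
Proof.
simpl; pose proof (exp_pos (- pz A)); split; intros h; [|rewrite h; ring].
apply Rmult_integral in h; lra.
Qed.

Lemma tcurve_in_plane_yz (A B : point) : A <> B ->
  (tcurve_in A B plane_yz <-> px A = px B).
Proof.
intros hne; split.
- intros h; specialize (h B (on_tcurve_right A B hne)).
  apply px_to_origin_0 in h; symmetry; exact h.
- intros e X hX; apply on_tcurve_iff in hX as (_ & l & ->).
  apply px_to_origin_0; rewrite px_tpath, e; ring.
Qed.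

Lemma tcurve_in_axis_z (A B : point) : A <> B ->
  (tcurve_in A B axis_z <-> px A = px B /\ py A = py B).
Proof.
intros hne; split.
- intros h; specialize (h B (on_tcurve_right A B hne)) as [h1 h2].
  apply px_to_origin_0 in h1; apply py_to_origin_0 in h2; auto.
- intros [e1 e2] X hX; apply on_tcurve_iff in hX as (_ & l & ->); split.
  + apply px_to_origin_0; rewrite px_tpath, e1; ring.
  + apply py_to_origin_0; rewrite py_tpath, e2; ring.
Qed.

(** If [A = B] there is no curve and it lies in every set, so that the hypothesis
    also makes the points distinct. *)
Lemma not_tcurve_in_axis_z (A B : point) : ~ tcurve_in A B axis_z ->
  A <> B /\ (px A <> px B \/ py A <> py B).
Proof.
intros h; assert (hne : A <> B).
{ intros <-; apply h; intros X hX; apply on_tcurve_iff in hX as [h' _].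
  exfalso; apply h'; reflexivity. }
split; [exact hne|]; rewrite tcurve_in_axis_z in h by exact hne.
destruct (Req_EM_T (px A) (px B)); [right|left]; tauto.
Qed.

Lemma tcurve_in_plane_xy_flat (A B : point) : pz A = pz B -> tcurve_in A B plane_xy.
Proof.
intros e X hX; apply on_tcurve_iff in hX as (_ & l & ->).
unfold plane_xy; simpl; rewrite e; ring.
Qed.

Lemma sratio_x (A P B : point) :
  on_tcurve A B P -> P <> B -> px A <> px B ->
  sratio A P B = (px P - px A) / (px B - px P).
Proof.
intros hP hPB hx; apply on_tcurve_iff in hP as (hne & l & ->).
assert (hl : l <> 1) by (intros ->; apply hPB, tpath_1).
set (c := pz B - pz A).
assert (hf : line_pos c l <> 1).
{ rewrite <- (line_pos_1 c); intros h; apply hl, (line_pos_inj c), h. }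
transitivity (line_pos c l / (1 - line_pos c l)).
2: { rewrite px_tpath; fold c; field; repeat split; try lra.
  replace (px B - (px A + line_pos c l * (px B - px A)))
    with ((1 - line_pos c l) * (px B - px A)) by ring.
  apply Rmult_integral_contrapositive; split; lra. }
unfold sratio.
destruct (excluded_middle_informative _) as [h|h].
- assert (hz : pz A = pz B).
  { destruct h as [h|h]; [apply tcurve_in_plane_xy; assumption|].
    apply tcurve_in_axis_z in h as [h _]; [contradiction|exact hne]. }
  rewrite sratio_dist_tpath by assumption.
  unfold c; replace (pz B - pz A) with 0 by lra; rewrite line_pos_flat; reflexivity.
- destruct (excluded_middle_informative (tcurve_in A B plane_yz)) as [h'|h'].
  + apply tcurve_in_plane_yz in h'; [contradiction|exact hne].
  + apply sratio_gen_tpath; [|exact hl].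
    intros e; apply h; left; apply tcurve_in_plane_xy_flat, e.
Qed.

Lemma tpath_origin (X : point) (l : R) : tpath origin X l = texp (vscale l (tlog X)).
Proof.
destruct X as [x y z]; unfold tpath, translate, to_origin, origin; simpl.
rewrite Ropp_0, exp_0, !Rminus_0_r, !Rmult_1_r, !Rplus_0_l; reflexivity.
Qed.

(** A side in a plane of constant x is measured in the half-plane
    (y, exp z), by the exchange of the two planes in the definition of [sratio]. *)
Lemma sratio_y (A P B : point) :
  on_tcurve A B P -> P <> B -> px A = px B -> py A <> py B ->
  sratio A P B = (py P - py A) / (py B - py P).
Proof.
intros hP hPB hx hy; apply on_tcurve_iff in hP as (hne & l & ->).
assert (hl : l <> 1) by (intros ->; apply hPB, tpath_1).
set (c := - (pz B - pz A)).
assert (hf : line_pos c l <> 1).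
{ rewrite <- (line_pos_1 c); intros h; apply hl, (line_pos_inj c), h. }
transitivity (line_pos c l / (1 - line_pos c l)).
2: { rewrite py_tpath; fold c; field; repeat split; try lra.
  replace (py B - (py A + line_pos c l * (py B - py A)))
    with ((1 - line_pos c l) * (py B - py A)) by ring.
  apply Rmult_integral_contrapositive; split; lra. }
unfold sratio.
destruct (excluded_middle_informative _) as [h|h].
- assert (hz : pz A = pz B).
  { destruct h as [h|h]; [apply tcurve_in_plane_xy; assumption|].
    apply tcurve_in_axis_z in h as [_ h]; [contradiction|exact hne]. }
  rewrite sratio_dist_tpath by assumption.
  unfold c; replace (- (pz B - pz A)) with 0 by lra; rewrite line_pos_flat; reflexivity.
- destruct (excluded_middle_informative (tcurve_in A B plane_yz)) as [h'|h'].
  2: { exfalso; apply h', tcurve_in_plane_yz; assumption. }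
  assert (hz : pz A <> pz B).
  { intros e; apply h; left; apply tcurve_in_plane_xy_flat, e. }
  replace (swap (to_origin A (tpath A B l))) with (tpath origin (swap (to_origin A B)) l).
  + rewrite sratio_gen_tpath; [|simpl; lra|exact hl].
    simpl; replace (- (pz B - pz A) - 0) with c by (unfold c; ring); reflexivity.
  + unfold tpath at 2; rewrite to_origin_translate, <- tpath_origin, swap_tpath.
    f_equal; unfold swap, origin; simpl; rewrite Ropp_0; reflexivity.
Qed.

(** * Collinearity in the half-plane *)

(** Twice the signed area of the triangle of images in the half-plane
    (x, exp (- z)); applied to images under [swap] it is the area in (y, exp z). *)
Definition xarea (A B C : point) : R :=
  (px B - px A) * (height C - height A) - (px C - px A) * (height B - height A).

Lemma height_to_origin (O A : point) : height (to_origin O A) = height A * exp (pz O).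
Proof.
unfold height; simpl; rewrite <- exp_plus; f_equal; ring.
Qed.

Lemma xarea_to_origin (O A B C : point) :
  xarea (to_origin O A) (to_origin O B) (to_origin O C) =
  xarea A B C * (exp (pz O) * exp (pz O)).
Proof. unfold xarea; rewrite !height_to_origin; simpl; ring. Qed.

Lemma xarea_to_origin_0 (O A B C : point) :
  xarea (to_origin O A) (to_origin O B) (to_origin O C) = 0 -> xarea A B C = 0.
Proof.
rewrite xarea_to_origin; intros h; pose proof (exp_pos (pz O)) as e.
apply Rmult_integral in h as [h|h]; [exact h|nra].
Qed.

Lemma on_tcurve_halfplane (A B X : point) : on_tcurve A B X ->
  exists m, px X = px A + m * (px B - px A) /\
            height X = height A + m * (height B - height A).
Proof.
intros h; apply on_tcurve_iff in h as (_ & l & ->).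
exists (line_pos (pz B - pz A) l); split; [apply px_tpath|apply height_tpath].
Qed.

Lemma on_tcurve_xarea (A B X : point) : on_tcurve A B X -> xarea A B X = 0.
Proof.
intros h; apply on_tcurve_halfplane in h as (m & e1 & e2).
unfold xarea; rewrite e1, e2; ring.
Qed.

Lemma on_tcurve_px_inj (A B X Y : point) : px A <> px B ->
  on_tcurve A B X -> on_tcurve A B Y -> px X = px Y -> X = Y.
Proof.
intros hx hX hY; apply on_tcurve_iff in hX as (_ & k & ->).
apply on_tcurve_iff in hY as (_ & l & ->).
rewrite !px_tpath; intros e; f_equal; apply (line_pos_inj (pz B - pz A)).
apply Rmult_eq_reg_r with (px B - px A); lra.
Qed.

(** On a side along which x varies, the ends are told apart from the other points
    by x, so that the denominators of the affine ratios do not vanish. *)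
Lemma on_tcurve_px_ends (A B X : point) : px A <> px B -> on_tcurve A B X ->
  (X <> A -> px X <> px A) /\ (X <> B -> px X <> px B).
Proof.
intros hx hX; assert (hne : A <> B) by congruence.
split; intros h e; apply h, (on_tcurve_px_inj A B); try assumption.
- apply on_tcurve_left, hne.
- apply on_tcurve_right, hne.
Qed.

Lemma height_inj (A B : point) : height A = height B -> pz A = pz B.
Proof. intros h; apply exp_inv in h; lra. Qed.

(** Collinear images in (x, exp (- z)) do not make three points lie on one curve;
    y must also be affine in exp z.  On a line along which the height varies,
    this is the same as y exp (- z) being an affine function of x and exp (- z),
    and on a line of constant height the latter makes y affine in x.  In this
    form the condition is what the equation of the surface provides. *)
Lemma on_tcurve_of_halfplane (A B X : point) (p q r : R) :
  px A <> px B -> xarea A B X = 0 ->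
  py A * height A = p * px A + q * height A + r ->
  py B * height B = p * px B + q * height B + r ->
  py X * height X = p * px X + q * height X + r ->
  on_tcurve A B X.
Proof.
intros hx ha eA eB eX.
apply on_tcurve_iff; split; [intros e; apply hx; rewrite e; reflexivity|].
pose proof (exp_pos (- pz A)) as wA; pose proof (exp_pos (- pz B)) as wB.
pose proof (exp_pos (- pz X)) as wX.
fold (height A) in wA; fold (height B) in wB; fold (height X) in wX.
destruct (Req_EM_T (pz A) (pz B)) as [hz|hz].
- assert (hh : height A = height B) by (unfold height; rewrite hz; reflexivity).
  set (l := (px X - px A) / (px B - px A)); exists l.
  unfold xarea in ha; rewrite <- hh in ha.
  assert (hX : height X = height A).
  { apply Rmult_eq_reg_l with (px B - px A); [lra|lra]. }
  pose proof (height_inj _ _ hX) as zX.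
  assert (exX : px X = px A + l * (px B - px A)) by (unfold l; field; lra).
  assert (eyX : py X = py A + l * (py B - py A)).
  { assert (hy : forall Y, height Y = height A ->
      py Y * height Y = p * px Y + q * height Y + r ->
      py Y = (p * px Y + q * height A + r) / height A).
    { intros Y -> e; rewrite <- e; field; lra. }
    rewrite (hy X), (hy A), (hy B), exX by auto; field; lra. }
  destruct X as [x y z]; simpl in *.
  pose proof (px_tpath A B l) as g1; pose proof (py_tpath A B l) as g2.
  pose proof (pz_tpath A B l) as g3.
  replace (pz B - pz A) with 0 in g1, g2, g3 by lra.
  rewrite Ropp_0 in g2; rewrite line_pos_flat in g1, g2.
  destruct (tpath A B l) as [x' y' z']; simpl in *.
  f_equal; lra.
- assert (hh : height A <> height B) by (intros e; apply hz, height_inj, e).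
  set (l := (pz X - pz A) / (pz B - pz A)); exists l.
  assert (ezX : pz X = pz A + l * (pz B - pz A)) by (unfold l; field; lra).
  assert (ew : height X = height (tpath A B l)).
  { unfold height; rewrite pz_tpath, <- ezX; reflexivity. }
  pose proof (height_tpath A B l) as g0; rewrite <- ew in g0.
  pose proof (px_tpath A B l) as g1; pose proof (py_tpath A B l) as g2.
  set (f := line_pos (pz B - pz A) l) in *.
  assert (ex : px X = px A + f * (px B - px A)).
  { apply Rmult_eq_reg_r with (height B - height A); [|lra].
    unfold xarea in ha; rewrite g0 in ha; lra. }
  assert (ey : py X = py (tpath A B l)).
  { rewrite g2; set (f' := line_pos (- (pz B - pz A)) l) in *.
    assert (g3 : / height X = / height A + f' * (/ height B - / height A)).
    { rewrite ew; unfold height; rewrite <- !exp_Ropp.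
      change (exp (- - pz (tpath A B l))) with (height (swap (tpath A B l))).
      rewrite swap_tpath, height_tpath; unfold f', height; simpl.
      replace (- pz B - - pz A) with (- (pz B - pz A)) by ring; reflexivity. }
    (* eliminating x along the image line makes y affine in the inverse height *)
    set (k := (px B - px A) / (height B - height A)).
    assert (kB : px B = px A + k * (height B - height A)) by (unfold k; field; lra).
    assert (kX : px X = px A + k * (height X - height A))
      by (rewrite ex, g0; unfold k; field; lra).
    assert (hy : forall Y, 0 < height Y -> px Y = px A + k * (height Y - height A) ->
      py Y * height Y = p * px Y + q * height Y + r ->
      py Y = (p * k + q) + (p * px A - p * k * height A + r) * / height Y).
    { intros Y hY eY e; apply Rmult_eq_reg_r with (height Y); [|lra].
      rewrite e, eY; field; lra. }
    rewrite (hy X), (hy A), (hy B), g3; try assumption; ring. }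
  destruct X as [x y z], (tpath A B l) as [x' y' z'] eqn:eg; simpl in *.
  pose proof (pz_tpath A B l) as g4; rewrite eg in g4; simpl in g4.
  f_equal; [lra|exact ey|lra].
Qed.

Lemma ttriangle_not_on_tcurve (A0 A1 A2 : point) : ttriangle A0 A1 A2 ->
  ~ on_tcurve A0 A1 A2.
Proof.
intros ht (phi & theta & t & (hr & t1 & _ & e1) & e2); apply ht.
exists A0, phi, theta, 0, t1, t; repeat split; try apply hr; try assumption.
apply tcurve_iff; [exact hr|].
rewrite to_origin_self, tlog_origin; unfold vscale, origin; simpl; f_equal; ring.
Qed.

(** * Ceva's theorem in the half-plane *)

(** [al], [be], [ga] are unnormalized barycentric coordinates of the common point,
    and [r], [m], [n] are the positions of the feet on the three sides.  If one
    weight were 0, the equations would propagate this around the triangle to all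
    of them; hence all are nonzero and cancel in the product of the equations. *)
Lemma ceva_weights (al be ga r m n : R) : al + be + ga <> 0 ->
  r <> 0 -> r <> 1 -> m <> 0 -> m <> 1 -> n <> 0 -> n <> 1 ->
  r * al = (1 - r) * be -> m * be = (1 - m) * ga -> (1 - n) * ga = n * al ->
  r / (1 - r) * (m / (1 - m)) * ((1 - n) / n) = 1.
Proof.
intros hs r0 r1 m0 m1 n0 n1 cP cQ cU.
assert (al0 : al <> 0).
{ intros ->; apply hs.
  assert (be = 0) by (apply Rmult_eq_reg_l with (1 - r); lra).
  assert (ga = 0) by (apply Rmult_eq_reg_l with (1 - n); lra). lra. }
assert (be0 : be <> 0).
{ intros ->; apply al0, Rmult_eq_reg_l with r; [rewrite cP; ring|exact r0]. }
assert (ga0 : ga <> 0).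
{ intros ->; apply be0, Rmult_eq_reg_l with m; [rewrite cQ; ring|exact m0]. }
assert (hceva : r * m * (1 - n) = (1 - r) * (1 - m) * n).
{ apply Rmult_eq_reg_r with (al * be * ga).
  - transitivity ((r * al) * (m * be) * ((1 - n) * ga)); [ring|].
    rewrite cP, cQ, cU; ring.
  - repeat apply Rmult_integral_contrapositive_currified; assumption. }
transitivity (r * m * (1 - n) / ((1 - r) * (1 - m) * n)).
- field; repeat split; lra.
- rewrite hceva; field; repeat split; lra.
Qed.

Lemma affine_ratio (a b x m : R) : x = a + m * (b - a) -> a <> b -> x <> b ->
  (x - a) / (b - x) = m / (1 - m).
Proof.
intros -> hab hx; assert (hm : m <> 1) by (intros ->; apply hx; ring).
field; split; [lra|].
replace (b - (a + m * (b - a))) with ((1 - m) * (b - a)) by ring.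
apply Rmult_integral_contrapositive_currified; lra.
Qed.

(** Concurrency is expressed by vanishing areas, which also makes sense when [T]
    has the image of a vertex; since the feet are not vertices, the area
    equations exclude this position by themselves. *)
Lemma ceva_halfplane (A0 A1 A2 T P Q U : point) :
  px A0 <> px A1 -> px A1 <> px A2 -> px A2 <> px A0 ->
  xarea A0 A1 A2 <> 0 ->
  on_tcurve A0 A1 P -> on_tcurve A1 A2 Q -> on_tcurve A0 A2 U ->
  xarea A0 T Q = 0 -> xarea A1 T U = 0 -> xarea A2 T P = 0 ->
  P <> A0 -> P <> A1 -> Q <> A1 -> Q <> A2 -> U <> A2 -> U <> A0 ->
  (px P - px A0) / (px A1 - px P) * ((px Q - px A1) / (px A2 - px Q))
    * ((px U - px A2) / (px A0 - px U)) = 1.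
Proof.
intros h01 h12 h20 hD hP hQ hU aQ aU aP nP0 nP1 nQ1 nQ2 nU2 nU0.
assert (h02 : px A0 <> px A2) by auto.
destruct (on_tcurve_px_ends A0 A1 P h01 hP) as [xP0 xP1].
destruct (on_tcurve_px_ends A1 A2 Q h12 hQ) as [xQ1 xQ2].
destruct (on_tcurve_px_ends A0 A2 U h02 hU) as [xU0 xU2].
specialize (xP0 nP0); specialize (xP1 nP1); specialize (xQ1 nQ1).
specialize (xQ2 nQ2); specialize (xU0 nU0); specialize (xU2 nU2).
apply on_tcurve_halfplane in hP as (r & eP & wP).
apply on_tcurve_halfplane in hQ as (m & eQ & wQ).
apply on_tcurve_halfplane in hU as (n & eU & wU).
rewrite (affine_ratio _ _ _ _ eP), (affine_ratio _ _ _ _ eQ) by assumption.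
replace ((px U - px A2) / (px A0 - px U)) with ((1 - n) / (1 - (1 - n))).
2: { symmetry; apply affine_ratio; [rewrite eU; ring|assumption..]. }
replace (1 - (1 - n)) with n by ring.
apply (ceva_weights (xarea T A1 A2) (xarea A0 T A2) (xarea A0 A1 T)).
- intros e; apply hD; rewrite <- e; unfold xarea; ring.
- intros ->; apply xP0; rewrite eP; ring.
- intros ->; apply xP1; rewrite eP; ring.
- intros ->; apply xQ1; rewrite eQ; ring.
- intros ->; apply xQ2; rewrite eQ; ring.
- intros ->; apply xU0; rewrite eU; ring.
- intros ->; apply xU2; rewrite eU; ring.
- apply Rminus_diag_uniq; rewrite <- aP; unfold xarea; rewrite eP, wP; ring.
- apply Rminus_diag_uniq; rewrite <- aQ; unfold xarea; rewrite eQ, wQ; ring.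
- apply Rminus_diag_uniq; rewrite <- aU; unfold xarea; rewrite eU, wU; ring.
Qed.

(** * Surfaces and connecting curves *)

(** The factor is [tdist P A] times the mean of [exp (- u)] over the difference
    of the z-coordinates: the velocity is a multiple of [tlog], which [texp] stretches by that
    mean in the direction x; [expmean_opp] makes the stretch in the direction y
    the same up to the weight [height A]. *)
Lemma ttangent_direction (P A v : point) : ttangent P A v ->
  exists k, k <> 0 /\ px A - px P = k * px v /\
    (py A - py P) * height A = k * py v * height P /\
    height P - height A = k * pz v * height P.
Proof.
intros (phi & theta & hd & d1 & d2 & d3).
apply tdir_iff in hd as (hne & hr & e).
pose proof (tdist_pos P A hne) as hp; set (d := tdist P A) in *.
assert (hv : px v = cos theta * cos phi * height P /\
  py v = cos theta * sin phi * / height P /\ pz v = sin theta).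
{ assert (hP : / height P = exp (pz P)).
  { unfold height; rewrite <- exp_Ropp; f_equal; ring. }
  rewrite hP; unfold tcurve, translate, tcurve0 in d1, d2, d3; simpl in d1, d2, d3.
  destruct (Req_EM_T theta 0) as [h0|h0]; simpl in d1, d2, d3.
  - rewrite h0, sin_0, cos_0.
    split; [|split].
    + apply (uniqueness_limite _ _ _ _ d1), is_derive_Reals.
      auto_derive; [exact I|unfold height; ring].
    + apply (uniqueness_limite _ _ _ _ d2), is_derive_Reals.
      auto_derive; [exact I|ring].
    + apply (uniqueness_limite _ _ _ _ d3), is_derive_Reals.
      auto_derive; [exact I|ring].
  - pose proof (sin_theta_neq0 theta (proj2 hr) h0).
    split; [|split].
    + apply (uniqueness_limite _ _ _ _ d1), is_derive_Reals.
      auto_derive; [exact I|].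
      rewrite Rmult_0_l, Ropp_0, exp_0; unfold height, cot; field; assumption.
    + apply (uniqueness_limite _ _ _ _ d2), is_derive_Reals.
      auto_derive; [exact I|].
      rewrite Rmult_0_l, exp_0; unfold cot; field; assumption.
    + apply (uniqueness_limite _ _ _ _ d3), is_derive_Reals.
      auto_derive; [exact I|ring]. }
destruct hv as (v1 & v2 & v3).
unfold tlog, to_origin, vscale, direction in e; simpl in e.
set (c := pz A - pz P) in *; injection e as e1 e2 e3.
pose proof (expmean_pos c) as hc; pose proof (expmean_mul c) as mc.
pose proof (expmean_opp c) as oc.
pose proof (exp_pos (- pz P)) as wP; fold (height P) in wP.
pose proof (exp_pos (- pz A)) as wA; fold (height A) in wA.
assert (hP : exp (pz P) = / height P).
{ unfold height; rewrite <- exp_Ropp; f_equal; ring. }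
assert (hA : height A = height P * exp (- c)).
{ unfold height, c; rewrite <- exp_plus; f_equal; ring. }
assert (hc' : exp c = height P / height A).
{ rewrite hA, exp_Ropp; field; split; apply Rgt_not_eq; [apply exp_pos|lra]. }
exists (d * expmean c); repeat split.
- apply Rgt_not_eq, Rmult_lt_0_compat; assumption.
- rewrite v1.
  transitivity (expmean c * height P * ((px A - px P) * exp (pz P) / expmean c)).
  + rewrite hP; field; lra.
  + rewrite e1; ring.
- rewrite v2; fold (height P) in e2; rewrite oc, hc' in e2.
  transitivity (expmean c *
    ((py A - py P) * height P / (expmean c * (height P / height A)))).
  + field; lra.
  + rewrite e2; field; lra.
- rewrite v3; transitivity (height P * (1 - exp (- c))); [rewrite hA; ring|].
  rewrite <- mc, e3; ring.
Qed.

(** Substituting the directions of the tangents in the equation of their common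
    plane gives an affine relation between x, y exp (- z) and exp (- z) that
    holds at the three vertices and vanishes at [T]. *)
Lemma surface_equation (A0 A1 A2 T : point) : surface A0 A1 A2 T ->
  T = A0 \/ T = A1 \/ T = A2 \/
  exists p q r, (p <> 0 \/ q <> 0 \/ r <> 0) /\
    forall A, A = A0 \/ A = A1 \/ A = A2 ->
      p * (px A - px T) + q * ((py A - py T) * height A) +
      r * (height A - height T) = 0.
Proof.
intros [h|[h|[h|(v0 & v1 & v2 & t0 & t1 & t2 & n & hn & d0 & d1 & d2)]]]; auto.
right; right; right.
pose proof (exp_pos (- pz T)) as wT; fold (height T) in wT.
exists (px n), (py n / height T), (- pz n / height T); split.
- apply NNPP; intros h; apply hn; destruct n as [a b c]; simpl in *.
  assert (a = 0) by (apply NNPP; intros ?; apply h; auto).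
  assert (b = 0).
  { apply NNPP; intros ?; apply h; right; left; unfold Rdiv.
    apply Rmult_integral_contrapositive_currified; [assumption|].
    apply Rinv_neq_0_compat; lra. }
  assert (c = 0).
  { apply NNPP; intros ?; apply h; right; right; unfold Rdiv.
    apply Rmult_integral_contrapositive_currified; [lra|].
    apply Rinv_neq_0_compat; lra. }
  subst; reflexivity.
- assert (hg : forall A v, ttangent T A v -> dot n v = 0 ->
    px n * (px A - px T) + py n / height T * ((py A - py T) * height A)
      + - pz n / height T * (height A - height T) = 0).
  { intros A v tA dA; apply ttangent_direction in tA as (k & _ & e1 & e2 & e3).
    replace (height A - height T) with (- (k * pz v * height T)) by lra.
    rewrite e1, e2; transitivity (k * dot n v).
    - unfold dot; field; lra.
    - rewrite dA; ring. }
  intros A [-> | [-> | ->]]; eapply hg; eassumption.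
Qed.

(** The three kinds of connecting curves all project into the line through the
    images of the end points; when these coincide, the area vanishes anyway. *)
Lemma connecting0_xarea (A1 A2 P1 P2 X : point) :
  connecting0 A1 A2 P1 P2 X -> xarea P1 P2 X = 0.
Proof.
intros [[_ h]|[(_ & _ & _ & c & s & (l & e) & ->)|(_ & ep & _ & eX)]].
- apply on_tcurve_xarea, h.
- destruct c as [x z]; unfold mmap, proj in e; simpl in e; injection e as e1 e2.
  unfold xarea, height; simpl; rewrite e1, e2; ring.
- unfold proj in ep; injection ep as e1 e2.
  unfold xarea, height; rewrite eX, e1, e2; ring.
Qed.

Lemma connecting_xarea (A0 A1 A2 P1 P2 X : point) :
  connecting A0 A1 A2 P1 P2 X -> xarea P1 P2 X = 0.
Proof.
intros h; apply (xarea_to_origin_0 A0); exact (connecting0_xarea _ _ _ _ _ h).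
Qed.

(** In the generic case a connecting curve is the whole part of the surface over
    its image line, and the vertices belong to the surface. *)
Lemma connecting_of_xarea (A0 A1 A2 P T X : point) :
  ~ ((plane_yz (to_origin A0 A1) /\ plane_yz (to_origin A0 A2)) \/
     (plane_xz (to_origin A0 A1) /\ plane_xz (to_origin A0 A2))) ->
  px P <> px T -> xarea P T X = 0 -> X = A0 \/ X = A1 \/ X = A2 ->
  connecting A0 A1 A2 P T X.
Proof.
intros hv hx ha hX; right; left; split; [exact hv|].
assert (hx' : px (to_origin A0 P) <> px (to_origin A0 T)).
{ simpl; intros e; apply Rmult_eq_reg_r in e; [lra|].
  apply Rgt_not_eq, exp_pos. }
split; [|split].
- intros e; apply hx'; unfold proj in e; congruence.
- unfold surface; destruct hX as [-> | [-> | ->]]; auto.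
  rewrite to_origin_self; auto.
- exists (proj (to_origin A0 X)), (py (to_origin A0 X)); split.
  2: { destruct (to_origin A0 X); reflexivity. }
  assert (ha' : xarea (to_origin A0 P) (to_origin A0 T) (to_origin A0 X) = 0).
  { rewrite xarea_to_origin, ha; ring. }
  set (P' := to_origin A0 P) in *; set (T' := to_origin A0 T) in *.
  set (X' := to_origin A0 X) in *; unfold xarea, height in ha'.
  exists ((px X' - px P') / (px T' - px P')); unfold mmap, proj; cbn [fst snd].
  f_equal; [field; lra|].
  apply Rmult_eq_reg_l with (px T' - px P'); [|lra].
  transitivity (exp (- pz P') * (px T' - px P')
    + (px X' - px P') * (exp (- pz T') - exp (- pz P'))); [lra|field; lra].
Qed.

(** The uniqueness of the intersection points excludes a triangle with collinear
    images: its surface would be the whole cylinder over the image line, and a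
    connecting curve along this line would contain an entire side. *)
Lemma xarea_neq0 (A0 A1 A2 T Q U : point) :
  px A0 <> px A1 -> px A1 <> px A2 -> px A2 <> px A0 ->
  ttriangle A0 A1 A2 -> surface A0 A1 A2 T ->
  meet_in (connecting A0 A1 A2 A0 T) (on_tcurve A1 A2) Q ->
  meet_in (connecting A0 A1 A2 A1 T) (on_tcurve A0 A2) U ->
  xarea A0 A1 A2 <> 0.
Proof.
intros h01 h12 h20 ht hT hQ hU ha.
assert (hcol : forall p q r,
  py A0 * height A0 = p * px A0 + q * height A0 + r ->
  py A1 * height A1 = p * px A1 + q * height A1 + r ->
  py A2 * height A2 = p * px A2 + q * height A2 + r -> False).
{ intros p q r e0 e1 e2; apply (ttriangle_not_on_tcurve A0 A1 A2 ht).
  apply on_tcurve_of_halfplane with p q r; assumption. }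
assert (hv : ~ ((plane_yz (to_origin A0 A1) /\ plane_yz (to_origin A0 A2)) \/
     (plane_xz (to_origin A0 A1) /\ plane_xz (to_origin A0 A2)))).
{ intros [[h _]|[h1 h2]].
  - apply px_to_origin_0 in h; auto.
  - apply py_to_origin_0 in h1; apply py_to_origin_0 in h2.
    (* a common value of y is the coefficient of the height in the relation *)
    apply (hcol 0 (py A0) 0); rewrite ?h1, ?h2; ring. }
assert (hl : xarea A0 A1 T = 0).
{ destruct (surface_equation _ _ _ _ hT) as
    [-> | [-> | [-> | (p & q & r & hn & he)]]]; [unfold xarea; ring..|exact ha|].
  pose proof (he A0 (or_introl eq_refl)) as e0.
  pose proof (he A1 (or_intror (or_introl eq_refl))) as e1.
  pose proof (he A2 (or_intror (or_intror eq_refl))) as e2.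
  destruct (Req_EM_T q 0) as [hq|hq].
  - rewrite hq in *; unfold xarea.
    assert (p * (px A1 - px A0) + r * (height A1 - height A0) = 0) by lra.
    destruct (Req_EM_T p 0) as [hp|hp].
    + rewrite hp in *; assert (hr : r <> 0) by tauto.
      assert (height A0 = height T) by (apply Rmult_eq_reg_l with r; lra).
      assert (height A1 = height T) by (apply Rmult_eq_reg_l with r; lra).
      replace (height A1) with (height T) by auto.
      replace (height A0) with (height T) by auto; ring.
    + apply Rmult_eq_reg_l with p; [|exact hp].
      replace (p * ((px A1 - px A0) * (height T - height A0)
        - (px T - px A0) * (height A1 - height A0))) with
        ((p * (px A1 - px A0)) * (height T - height A0)
        + (p * (px A0 - px T)) * (height A1 - height A0)) by ring.
      replace (p * (px A1 - px A0)) with (- (r * (height A1 - height A0))) by lra.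
      replace (p * (px A0 - px T)) with (- (r * (height A0 - height T))) by lra.
      ring.
  (* a nonzero coefficient of y puts the vertices on one translation curve *)
  - exfalso; apply (hcol (- p / q) (py T - r / q) ((p * px T + r * height T) / q));
      apply Rmult_eq_reg_l with q; try exact hq.
    + transitivity (- p * (px A0 - px T) + q * py T * height A0
        - r * (height A0 - height T)); [lra|field; exact hq].
    + transitivity (- p * (px A1 - px T) + q * py T * height A1
        - r * (height A1 - height T)); [lra|field; exact hq].
    + transitivity (- p * (px A2 - px T) + q * py T * height A2
        - r * (height A2 - height T)); [lra|field; exact hq]. }
assert (n12 : A1 <> A2) by (intros e; apply h12; rewrite e; reflexivity).
assert (n02 : A0 <> A2) by (intros e; apply h20; rewrite e; reflexivity).
assert (ha02 : xarea A0 T A2 = 0 /\ xarea A1 T A2 = 0).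
{ split; apply Rmult_eq_reg_l with (px A1 - px A0); try lra.
  - transitivity ((px T - px A0) * xarea A0 A1 A2 - (px A2 - px A0) * xarea A0 A1 T);
      [unfold xarea; ring|rewrite ha, hl; ring].
  - transitivity ((px T - px A1) * xarea A0 A1 A2 - (px A2 - px A1) * xarea A0 A1 T);
      [unfold xarea; ring|rewrite ha, hl; ring]. }
(* the curve from [A0] lies over a line only if [A0] and [T] differ in x;
   otherwise [A1] and [T] do *)
destruct (Req_EM_T (px A0) (px T)) as [e|hne].
- assert (x1 : px A1 <> px T) by lra.
  apply n02; transitivity U; [|symmetry]; apply hU; split.
  + apply connecting_of_xarea; auto.
    transitivity (xarea A0 A1 T); [unfold xarea; ring|exact hl].
  + apply on_tcurve_left, n02.
  + apply connecting_of_xarea; auto; apply ha02.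
  + apply on_tcurve_right, n02.
- apply n12; transitivity Q; [|symmetry]; apply hQ; split.
  + apply connecting_of_xarea; auto.
    transitivity (- xarea A0 A1 T); [unfold xarea; ring|rewrite hl; ring].
  + apply on_tcurve_left, n12.
  + apply connecting_of_xarea; auto; apply ha02.
  + apply on_tcurve_right, n12.
Qed.

Lemma swap_inj (A B : point) : swap A = swap B -> A = B.
Proof. intros e; rewrite <- (swap_swap A), e; apply swap_swap. Qed.

(** For a triangle in a plane of constant x the connecting curves are translation
    curves, and these also project to lines in the half-plane (y, exp z). *)
Lemma connecting_xarea_swap (A0 A1 A2 P1 P2 X : point) :
  plane_yz (to_origin A0 A1) /\ plane_yz (to_origin A0 A2) ->
  connecting A0 A1 A2 P1 P2 X -> xarea (swap P1) (swap P2) (swap X) = 0.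
Proof.
intros hv h; apply (xarea_to_origin_0 (swap A0)); rewrite <- !swap_to_origin.
destruct h as [[_ h]|[[h _]|[h _]]]; [|exfalso; apply h; left; exact hv..].
apply on_tcurve_xarea, swap_on_tcurve, h.
Qed.

(** * Ceva's theorem for translation triangles *)

Theorem theorem3p24 :
  forall A0 A1 A2 T P Q U : point,
  ttriangle A0 A1 A2 ->
  no_side_along_axis_z A0 A1 A2 ->
  sides_yz_consistent A0 A1 A2 ->
  surface A0 A1 A2 T ->
  ~ on_tsegment A0 A1 T -> ~ on_tsegment A1 A2 T -> ~ on_tsegment A2 A0 T ->
  meet_in (connecting A0 A1 A2 A0 T) (on_tcurve A1 A2) Q ->
  meet_in (connecting A0 A1 A2 A1 T) (on_tcurve A0 A2) U ->
  meet_in (connecting A0 A1 A2 A2 T) (on_tcurve A0 A1) P ->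
  P <> A0 -> P <> A1 -> Q <> A1 -> Q <> A2 -> U <> A2 -> U <> A0 ->
  sratio A0 P A1 * sratio A1 Q A2 * sratio A2 U A0 = 1.
Proof.
intros A0 A1 A2 T P Q U ht (ax01 & ax12 & ax20) hyz hT _ _ _ hQ hU hP
  nP0 nP1 nQ1 nQ2 nU2 nU0.
apply not_tcurve_in_axis_z in ax01 as [n01 ax01], ax12 as [n12 ax12], ax20 as [n20 ax20].
destruct (proj2 (hQ Q) eq_refl) as [cQ sQ].
destruct (proj2 (hU U) eq_refl) as [cU sU].
destruct (proj2 (hP P) eq_refl) as [cP sP].
unfold sides_yz_consistent in hyz; rewrite !tcurve_in_plane_yz in hyz by assumption.
destruct (classic (px A0 = px A1 \/ px A1 = px A2 \/ px A2 = px A0)) as [hx|hx].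
- apply hyz in hx; assert (hv := hx); destruct hx as [hx1 hx2].
  apply px_to_origin_0 in hx1; apply px_to_origin_0 in hx2.
  assert (y01 : py A0 <> py A1) by (destruct ax01; [congruence|assumption]).
  assert (y12 : py A1 <> py A2) by (destruct ax12; [congruence|assumption]).
  assert (y20 : py A2 <> py A0) by (destruct ax20; [congruence|assumption]).
  rewrite !sratio_y by (auto using on_tcurve_sym; congruence).
  (* the triangle is in a plane of constant x, hence the other half-plane *)
  apply (ceva_halfplane (swap A0) (swap A1) (swap A2) (swap T)
    (swap P) (swap Q) (swap U));
    auto using swap_on_tcurve; try (intros e; apply swap_inj in e; contradiction).
  + intros ha; apply (ttriangle_not_on_tcurve A0 A1 A2 ht).
    rewrite <- (swap_swap A0), <- (swap_swap A1), <- (swap_swap A2).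
    apply swap_on_tcurve, on_tcurve_of_halfplane with 0 (px A0) 0; simpl; auto;
      rewrite ?hx1, ?hx2; ring.
  + apply (connecting_xarea_swap A0 A1 A2); assumption.
  + apply (connecting_xarea_swap A0 A1 A2); assumption.
  + apply (connecting_xarea_swap A0 A1 A2); assumption.
- assert (x01 : px A0 <> px A1) by tauto.
  assert (x12 : px A1 <> px A2) by tauto.
  assert (x20 : px A2 <> px A0) by tauto.
  rewrite !sratio_x by (auto using on_tcurve_sym).
  apply (ceva_halfplane A0 A1 A2 T P Q U); auto.
  + apply (xarea_neq0 A0 A1 A2 T Q U); assumption.
  + apply (connecting_xarea A0 A1 A2 A0 T Q cQ).
  + apply (connecting_xarea A0 A1 A2 A1 T U cU).
  + apply (connecting_xarea A0 A1 A2 A2 T P cP).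
Qed.
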